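(* Fix an imprecise probabilities tree with finite state space $\mathscr{X}$, and let $\overline{\mathrm{E}}_{\mathrm V}$ be the corresponding game-theoretic upper expectation. For any situation $s\in\mathscr{X}^{\ast}$ and any $f\in\overline{\mathbb{V}}_{b,\mathrm{lim}}$ (that is, any bounded below $f\colon\Omega\to\overline{\mathbb{R}}$ that is the pointwise limit of some sequence of finitary variables), there is a sequence $\{f_n\}_{n\in\mathbb{N}_0}$ of gambles on $\Omega$, with $f_n$ being $n$-measurable for every $n\in\mathbb{N}_0$, that is uniformly bounded below (there is $M\in\mathbb{R}$ with $f_n\ge M$ for all $n$) and converges pointwise to $f$, such that \[\lim_{n\to+\infty}\overline{\mathrm{E}}_{\mathrm V}(f_n\vert s)=\overline{\mathrm{E}}_{\mathrm V}(f\vert s).\]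
   Context: Notation: $\mathbb{N}=\{1,2,\dots\}$, $\mathbb{N}_0=\mathbb{N}\cup\{0\}$, $\overline{\mathbb{R}}=\mathbb{R}\cup\{-\infty,+\infty\}$, with conventions $+\infty-\infty=-\infty+\infty=+\infty$, $0\cdot(\pm\infty)=0$, $\inf\emptyset=+\infty$. For a non-empty set $\mathscr{Y}$, $\overline{\mathscr{L}}(\mathscr{Y})$ is the set of all maps $\mathscr{Y}\to\overline{\mathbb{R}}$ and $\overline{\mathscr{L}}_b(\mathscr{Y})$ the subset of those bounded below by a real constant; a gamble on $\mathscr{Y}$ is a bounded real-valued map on $\mathscr{Y}$. Limits and inequalities of functions are pointwise. Local models: $\mathscr{X}$ is a finite non-empty set. $\mathscr{X}^{\ast}=\bigcup_{n\in\mathbb{N}_0}\mathscr{X}^n$ is the set of situations (finite strings, including the empty string $\Box$). An imprecise probabilities tree assigns to each $s\in\mathscr{X}^{\ast}$ a map $\overline{\mathrm{Q}}_s\colon\overline{\mathscr{L}}(\mathscr{X})\to\overline{\mathbb{R}}$ that is an upper expectation, i.e. satisfies: (E1) $\overline{\mathrm{Q}}_s(c)=c$ for all $c\in\mathbb{R}$; (E2) $\overline{\mathrm{Q}}_s(f+g)\le\overline{\mathrm{Q}}_s(f)+\overline{\mathrm{Q}}_s(g)$ for all $f,g\in\overline{\mathscr{L}}_b(\mathscr{X})$; (E3) $\overline{\mathrm{Q}}_s(\lambda f)=\lambda\overline{\mathrm{Q}}_s(f)$ for all real $\lambda>0$ and $f\in\overline{\mathscr{L}}_b(\mathscr{X})$;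 (E4) $f\le g\Rightarrow\overline{\mathrm{Q}}_s(f)\le\overline{\mathrm{Q}}_s(g)$ for all $f,g\in\overline{\mathscr{L}}_b(\mathscr{X})$; (E5) $\lim_n\overline{\mathrm{Q}}_s(f_n)=\overline{\mathrm{Q}}_s(\lim_n f_n)$ for every non-decreasing sequence $\{f_n\}_{n\in\mathbb{N}_0}$ of non-negative variables in $\overline{\mathscr{L}}_b(\mathscr{X})$. Global model: $\Omega=\mathscr{X}^{\mathbb{N}}$ is the set of paths; for $\omega\in\Omega$, $\omega^n\in\mathscr{X}^n$ is the string of its first $n$ values; $\Gamma(x_{1:n})=\{\omega\in\Omega:\omega^n=x_{1:n}\}$. For $g,h\colon\Omega\to\overline{\mathbb{R}}$, $g\ge_s h$ means $g(\omega)\ge h(\omega)$ for all $\omega\in\Gamma(s)$. A supermartingale is a map $\mathscr{M}\colon\mathscr{X}^{\ast}\to\overline{\mathbb{R}}$ with $\overline{\mathrm{Q}}_s(\mathscr{M}(s\,\cdot))\le\mathscr{M}(s)$ for all $s\in\mathscr{X}^{\ast}$, where $\mathscr{M}(s\,\cdot)\in\overline{\mathscr{L}}(\mathscr{X})$ is $x\mapsto\mathscr{M}(sx)$. $\overline{\mathbb{M}}_{\mathrm b}$ is the set of supermartingales bounded below by a real constant, and $\liminf\mathscr{M}(\omega)=\liminf_{n\to+\infty}\mathscr{M}(\omega^n)$. The game-theoretic upper expectation is, for all $f\colon\Omega\to\overline{\mathbb{R}}$ and $s\in\mathscr{X}^{\ast}$, \[\overline{\mathrm{E}}_{\mathrm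 V}(f\vert s)=\inf\{\mathscr{M}(s):\mathscr{M}\in\overline{\mathbb{M}}_{\mathrm b},\ \liminf\mathscr{M}\ge_s f\}.\] A variable $f\colon\Omega\to\overline{\mathbb{R}}$ is $n$-measurable if $f(\omega)$ depends only on $\omega^n$, and finitary if it is $n$-measurable for some $n\in\mathbb{N}_0$. $\overline{\mathbb{V}}_{b,\mathrm{lim}}$ is the set of all bounded below $f\colon\Omega\to\overline{\mathbb{R}}$ such that $f=\lim_{n\to+\infty}f_n$ pointwise for some sequence $\{f_n\}_{n\in\mathbb{N}_0}$ of finitary extended real variables. *)

(* Defs.v *)
From HB Require Import structures.
From mathcomp Require Import all_boot all_order all_algebra.
From mathcomp Require Import all_classical all_reals all_analysis.

Set Implicit Arguments.
Unset Strict Implicit.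
Unset Printing Implicit Defensive.

Import Order.TTheory GRing.Theory Num.Theory.
Import numFieldNormedType.Exports.

Local Open Scope classical_set_scope.
Local Open Scope ring_scope.
Local Open Scope ereal_scope.

Definition bounded_below (R : realType) (Y : Type) (f : Y -> \bar R) : Prop :=
  exists M : R, forall y, M%:E <= f y.

Definition gamble (R : realType) (Y : Type) (f : Y -> R) : Prop :=
  bounded_fun f.

(* The sum in ue_subadditive is the dual one, for which +oo + -oo = +oo; the
   default one on \bar R has +oo + -oo = -oo. *)
Record upper_expectation (R : realType) (X : finType)
    (Q : (X -> \bar R) -> \bar R) : Prop := UpperExpectation {
  ue_cst : forall c : R, Q (fun=> c%:E) = c%:E ;
  ue_subadditive : forall f g : X -> \bar R,
    bounded_below f -> bounded_below g ->
    Q (fun x => (f x + g x)%dE) <= (Q f + Q g)%dE ;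
  ue_homogeneous : forall (l : R) (f : X -> \bar R),
    (0 < l)%R -> bounded_below f ->
    Q (fun x => l%:E * f x) = l%:E * Q f ;
  ue_monotone : forall f g : X -> \bar R,
    bounded_below f -> bounded_below g ->
    (forall x, f x <= g x) -> Q f <= Q g ;
  ue_continuous : forall f_ : nat -> X -> \bar R,
    (forall n, bounded_below (f_ n)) ->
    (forall n x, 0 <= f_ n x) ->
    (forall n x, f_ n x <= f_ n.+1 x) ->
    Q (f_ n) @[n --> \oo] --> Q (fun x => limn (f_ ^~ x)) }.

(* Situations are finite strings over X, with [::] as the empty one. *)
Definition situation (X : finType) : Type := seq X.

Definition imprecise_probabilities_tree (R : realType) (X : finType)
    (Q : situation X -> (X -> \bar R) -> \bar R) : Prop :=
  forall s, upper_expectation (Q s).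

(* The value of a path at the (one-based) time k is w k.-1. *)
Definition paths (X : finType) : Type := nat -> X.

Definition prefix_at (X : finType) (w : paths X) (n : nat) : situation X :=
  mkseq w n.

Definition cylinder (X : finType) (s : situation X) : set (paths X) :=
  [set w | prefix_at w (size s) = s].

Definition supermartingale (R : realType) (X : finType)
    (Q : situation X -> (X -> \bar R) -> \bar R)
    (M : situation X -> \bar R) : Prop :=
  forall s, Q s (fun x => M (rcons s x)) <= M s.

Definition liminf_path (R : realType) (X : finType)
    (M : situation X -> \bar R) (w : paths X) : \bar R :=
  limn_einf (fun n => M (prefix_at w n)).

Definition game_upper_expectation (R : realType) (X : finType)
    (Q : situation X -> (X -> \bar R) -> \bar R)
    (f : paths X -> \bar R) (s : situation X) : \bar R :=
  ereal_inf [set a | exists M : situation X -> \bar R,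
    [/\ supermartingale Q M,
        bounded_below M,
        forall w, cylinder s w -> f w <= liminf_path M w
      & a = M s]].

Definition n_measurable (X : finType) (T : Type) (n : nat)
    (f : paths X -> T) : Prop :=
  forall w w', prefix_at w n = prefix_at w' n -> f w = f w'.

Definition finitary (X : finType) (T : Type) (f : paths X -> T) : Prop :=
  exists n, n_measurable n f.

Definition bounded_below_finitary_limit (R : realType) (X : finType)
    (f : paths X -> \bar R) : Prop :=
  bounded_below f /\
  exists f_ : nat -> paths X -> \bar R,
    (forall n, finitary (f_ n)) /\
    forall w, f_ n w @[n --> \oo] --> f w.

(* Main.v *)
(* Truncating at k, let h^k_i be the clipping of F_i to [0, k], where F_i are
   finitary with limit f >= 0. If M is a supermartingale with liminf M >= f, the
   excess of h^k_i over M at time i is a bounded sequence of continuous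
   functions on the compact space of paths that tends to 0 pointwise; by Mazur's
   theorem (proved here combinatorially) some convex mean of a tail of it is
   uniformly small. Since M stopped at time i has value M(s) in s, the same mean
   of the h^k_i has upper expectation at most E(f|s) + 1/(k+1), and these means
   still converge to f. The bound from below is a Fatou lemma: the lower limit of
   the E(f_n|.) is a supermartingale, whose lower limit can only be less than f
   on paths along which it makes infinitely many upcrossings in the sense of Doob;
   those are charged by supermartingales of arbitrarily small initial value. *)
Require Import Defs.
From HB Require Import structures.
From mathcomp Require Import all_boot all_order all_algebra.
From mathcomp Require Import all_classical all_reals all_analysis.
From mathcomp Require Import ring lra.

Set Implicit Arguments.
Unset Strict Implicit.
Unset Printing Implicit Defensive.

Import Order.TTheory GRing.Theory Num.Theory.
Import numFieldNormedType.Exports.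

Local Open Scope classical_set_scope.
Local Open Scope ring_scope.
Local Open Scope ereal_scope.

(** * Lower limits and local models *)

Lemma lte_between (R : realType) (x y : \bar R) :
  x < y -> exists a : R, x < a%:E /\ a%:E < y.
Proof.
case: x => [r||]; case: y => [r'||] //=; rewrite ?lte_fin => h.
- by exists ((r + r') / 2)%R; rewrite !lte_fin; split; lra.
- by exists (r + 1)%R; rewrite lte_fin ltry; split => //; lra.
- by exists (r' - 1)%R; rewrite lte_fin ltNyr; split => //; lra.
- by exists 0%R; rewrite ltry ltNyr.
Qed.

Lemma lee_from_below (R : realType) (x y : \bar R) :
  (forall a : R, a%:E < x -> a%:E <= y) -> x <= y.
Proof.
move=> h; rewrite leNgt; apply/negP => /lte_between[a [ya /h]].
by rewrite leNgt ya.
Qed.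

Lemma limn_einf_gt (R : realType) (u : nat -> \bar R) (a : \bar R) :
  a < limn_einf u -> exists N, forall n, (N <= n)%N -> a < u n.
Proof.
rewrite limn_einf_lim (cvg_lim _ (@cvg_einfs_sup _ u)) //.
move=> /ereal_sup_gt[_ [N _ <-] aN]; exists N => n Nn.
by apply: (lt_le_trans aN); apply: ereal_inf_lbound; exists n.
Qed.

Lemma limn_einf_ge (R : realType) (u : nat -> \bar R) (a : \bar R) (N : nat) :
  (forall n, (N <= n)%N -> a <= u n) -> a <= limn_einf u.
Proof.
move=> h; rewrite limn_einf_lim (cvg_lim _ (@cvg_einfs_sup _ u)) //.
apply: (@le_trans _ _ (einfs u N)); last by apply: ereal_sup_ubound; exists N.
by apply: le_ereal_inf_tmp => _ [n /= Nn <-]; apply: h.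
Qed.

Lemma le_limn_einf (R : realType) (u v : nat -> \bar R) (N : nat) :
  (forall n, (N <= n)%N -> u n <= v n) -> limn_einf u <= limn_einf v.
Proof.
move=> h; apply: lee_from_below => a /limn_einf_gt[N' h'].
apply: (@limn_einf_ge _ _ _ (maxn N N')) => n; rewrite geq_max => /andP[h1 h2].
by apply: ltW; apply: (lt_le_trans (h' _ h2)); apply: h.
Qed.

Lemma cvge_from_bounds (R : realType) (u : nat -> \bar R) (l : \bar R) :
  (forall a : R, a%:E < l -> exists N, forall n, (N <= n)%N -> a%:E <= u n) ->
  (forall b : R, l < b%:E -> exists N, forall n, (N <= n)%N -> u n <= b%:E) ->
  u n @[n --> \oo] --> l.
Proof.
move=> hl hu.
have lu : l <= limn_einf u.
  by apply: lee_from_below => a /hl[N hN]; apply: limn_einf_ge hN.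
have ul : limn_esup u <= l.
  rewrite -leeN2 -limn_einfN; apply: lee_from_below => a.
  rewrite lteNr => /hu[N hN]; apply: (@limn_einf_ge _ _ _ N) => n Nn /=.
  by rewrite leeNr; apply: hN.
have eu : limn_einf u = limn_esup u.
  by apply/eqP; rewrite eq_le limn_einf_sup (le_trans ul lu).
have el : limn_einf u = l.
  by apply/eqP; rewrite eq_le lu eu ul.
apply: (@squeeze_cvge _ _ _ _ (einfs u) u (esups u)).
- apply: nearW => n; apply/andP; split.
    by apply: ereal_inf_lbound; exists n => /=.
  by apply: ereal_sup_ubound; exists n => /=.
- by rewrite -[X in _ --> X]el limn_einf_lim; exact: is_cvg_einfs.
- by rewrite -[X in _ --> X]el eu limn_esup_lim; exact: is_cvg_esups.
Qed.

Section local_model.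
Variables (R : realType) (X : finType) (Q : (X -> \bar R) -> \bar R).
Hypothesis hQ : upper_expectation Q.

Lemma ue_ge (c : R) (f : X -> \bar R) : (forall x, c%:E <= f x) -> c%:E <= Q f.
Proof.
move=> h; rewrite -{1}(ue_cst hQ c); apply: (ue_monotone hQ) => //.
- by exists c.
- by exists c.
Qed.

(** The two sums differ only on +oo and -oo together, and the bounds below exclude -oo, so
    subadditivity passes from the dual sum to the default one. *)
Lemma ue_addD (c d : R) (f g : X -> \bar R) :
  (forall x, c%:E <= f x) -> (forall x, d%:E <= g x) ->
  Q (fun x => f x + g x) <= Q f + Q g.
Proof.
move=> hf hg.
have gtN (e : R) (z : \bar R) : e%:E <= z -> z != -oo.
  by case: z.
have dE (y z : \bar R) : y != -oo -> z != -oo -> (y + z)%dE = y + z.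
  by case: y => [y||]; case: z => [z||].
rewrite -dE ?(gtN c _ (ue_ge hf)) ?(gtN d _ (ue_ge hg)) //.
have -> : (fun x => f x + g x) = (fun x => (f x + g x)%dE).
  by apply/funext => x; rewrite dE ?(gtN c _ (hf x)) ?(gtN d _ (hg x)).
by apply: (ue_subadditive hQ); [exists c|exists d].
Qed.

(** Fatou's lemma for a local model: the tail infima [einfs] increase to the lower limit, so
    continuity along non-decreasing sequences applies to them. *)
Lemma ue_liminf (f_ : nat -> X -> \bar R) :
  (forall n x, 0 <= f_ n x) ->
  Q (fun x => limn_einf (f_ ^~ x)) <= limn_einf (fun n => Q (f_ n)).
Proof.
move=> f0; pose g n x := einfs (f_ ^~ x) n.
have g0 n x : 0 <= g n x by apply: le_ereal_inf_tmp => _ [m _ <-].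
have gS n x : g n x <= g n.+1 x by apply: nondecreasing_einfs.
have bg n : bounded_below (g n) by exists 0%R.
have -> : (fun x => limn_einf (f_ ^~ x)) = (fun x => limn (g ^~ x)).
  by apply/funext => x; rewrite limn_einf_lim.
rewrite -(cvg_lim _ (ue_continuous hQ bg g0 gS)) //.
rewrite -is_cvg_limn_einfE; last first.
  by apply/cvg_ex; eexists; exact: (ue_continuous hQ bg g0 gS).
apply: (@le_limn_einf _ _ _ 0%N) => n _; apply: (ue_monotone hQ) => //.
  by exists 0%R.
by move=> x; apply: ereal_inf_lbound; exists n => /=.
Qed.

End local_model.

(** * Situations and supermartingales *)

Section situations.
Variable X : finType.
Implicit Types (s t u : situation X) (w : paths X).

Lemma prefix_atS w n : prefix_at w n.+1 = rcons (prefix_at w n) (w n).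
Proof. exact: mkseqS. Qed.

Lemma size_prefix_at w n : size (prefix_at w n) = n.
Proof. exact: size_mkseq. Qed.

Lemma take_prefix_at w m n : (m <= n)%N ->
  take m (prefix_at w n) = prefix_at w m.
Proof. by move=> mn; rewrite /prefix_at /mkseq -map_take take_iota (minn_idPl mn). Qed.

Lemma prefix_prefix_at s w n : (size s <= n)%N ->
  prefix s (prefix_at w n) <-> cylinder s w.
Proof.
by move=> sn; rewrite prefixE take_prefix_at //; split => [/eqP|->].
Qed.

Lemma cylinder_prefix s t w : prefix s t -> cylinder t w -> cylinder s w.
Proof.
move=> st tw; apply/(@prefix_prefix_at _ _ (size t)); first exact: size_prefix.
by rewrite tw.
Qed.

Lemma nth_prefix x0 s t i : prefix s t -> (i < size s)%N ->
  nth x0 t i = nth x0 s i.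
Proof. by move=> /prefixP[r ->] si; rewrite nth_cat si. Qed.

Lemma path_of_chain (hX : (0 < #|X|)%N) (v : nat -> situation X) :
  (forall k, prefix (v k) (v k.+1)) ->
  (forall k, (size (v k) < size (v k.+1))%N) ->
  exists w, forall k, cylinder (v k) w.
Proof.
case/card_gt0P: hX => x0 _ vp vs.
have sz k : (k <= size (v k))%N.
  by elim: k => // k IH; apply: (leq_ltn_trans IH).
have vpD k j : prefix (v k) (v (k + j)%N).
  elim: j => [|j IH]; first by rewrite addn0 prefix_refl.
  by rewrite addnS; apply: (prefix_trans IH).
(* [v n.+1] has length at least [n.+1], so the default [x0] is never read. *)
exists (fun n => nth x0 (v n.+1) n) => k.
apply: (@eq_from_nth _ x0); rewrite size_prefix_at // => i ik.
rewrite nth_mkseq //; case/orP: (leq_total k i.+1) => [/subnKC <-|/subnKC e].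
  by rewrite (nth_prefix _ (vpD _ _)).
by rewrite -[in RHS]e (nth_prefix _ (vpD _ _)) // sz.
Qed.

(** Dependent choice in the tree: [F] picks a child in [P], and iterating it from [t] traces the
    path. *)
Lemma path_from (hX : (0 < #|X|)%N) (P : situation X -> Prop) t :
  P t -> (forall u, P u -> exists x, P (rcons u x)) ->
  exists w, cylinder t w /\ forall n, (size t <= n)%N -> P (prefix_at w n).
Proof.
move=> Pt PS.
have [F hF] : exists F : situation X -> X, forall u, P u -> P (rcons u (F u)).
  case/card_gt0P: (hX) => x0 _.
  have /choice[F hF] : forall u, exists x, P u -> P (rcons u x).
    move=> u; have [/PS[x hx]|nPu] := pselect (P u); first by exists x.
    by exists x0.
  by exists F.
pose v k := iter k (fun u => rcons u (F u)) t.
have Pv k : P (v k) by elim: k => //= k IH; apply: hF.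
have [||w hw] := @path_of_chain hX v.
- by move=> k; rewrite /v /= prefix_rcons.
- by move=> k; rewrite /v /= size_rcons.
exists w; split; first exact: (hw 0%N).
have sz k : size (v k) = (size t + k)%N.
  by elim: k => [|k IH]; rewrite ?addn0 // /v /= size_rcons IH addnS.
by move=> n /subnKC <-; rewrite -sz (hw _).
Qed.

End situations.

(** * Basic properties of the game-theoretic upper expectation *)

Section game.
Variables (R : realType) (X : finType) (hX : (0 < #|X|)%N).
Variable Q : situation X -> (X -> \bar R) -> \bar R.
Hypothesis hQ : imprecise_probabilities_tree Q.
Implicit Types (s t u : situation X) (w : paths X) (M N : situation X -> \bar R).
Implicit Types (f g : paths X -> \bar R).
Local Notation E := (game_upper_expectation Q).

(** If [M t < a < c], every situation where [M] is below [a] has a child with the same property,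
    since [ue_ge] would otherwise force its value up to [a]. Following such children gives a path
    with lower limit at most [a]. *)
Lemma supermartingale_ge M (c : R) t : supermartingale Q M -> bounded_below M ->
  (forall w, cylinder t w -> c%:E <= liminf_path M w) -> c%:E <= M t.
Proof.
move=> sM [B MB] h; rewrite leNgt; apply/negP => /lte_between[a [Ma ac]].
have [//||w [tw wa]] := @path_from _ hX (fun u => M u < a%:E) t.
  move=> u Mu; apply: contrapT => /forallNP nx; move: Mu; apply/negP.
  rewrite -leNgt; apply: le_trans (sM u); apply: (ue_ge (hQ u)) => x.
  by rewrite leNgt; apply/negP/nx.
have /limn_einf_gt[n hn] : a%:E < liminf_path M w.
  exact: (lt_le_trans ac (h _ tw)).
have := hn (maxn n (size t)) (leq_maxl _ _).
by rewrite ltNge ltW // wa // leq_maxr.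
Qed.

Lemma game_le M f t : supermartingale Q M -> bounded_below M ->
  (forall w, cylinder t w -> f w <= liminf_path M w) -> E f t <= M t.
Proof. by move=> *; apply: ereal_inf_lbound; exists M. Qed.

Lemma game_ge (c : R) f t : (forall w, cylinder t w -> c%:E <= f w) ->
  c%:E <= E f t.
Proof.
move=> cf; apply: le_ereal_inf_tmp => _ [M [sM bM fM ->]].
by apply: supermartingale_ge => // w tw; apply: le_trans (fM _ tw); apply: cf.
Qed.

Lemma le_game f g t : (forall w, cylinder t w -> f w <= g w) -> E f t <= E g t.
Proof.
move=> fg; apply: le_ereal_inf_tmp => _ [M [sM bM gM ->]].
by apply: game_le => // w tw; apply: le_trans (gM _ tw); apply: fg.
Qed.

(** A supermartingale from the infimum dominates [f] only on the cylinder of [t]; the value +oo off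
    the subtree at [t] makes the domination global. Positivity comes from [supermartingale_ge]. *)
Lemma game_lt_dominated f t (a : \bar R) : (forall w, 0 <= f w) -> E f t < a ->
  exists M, [/\ supermartingale Q M, forall u, 0 <= M u, M t < a &
    forall w, f w <= liminf_path M w].
Proof.
move=> f0 /ereal_inf_lt[_ [M0 [sM bM fM ->]] Ma].
exists (fun u => if prefix t u then M0 u else +oo); split.
- move=> u; case: ifP => tu; last by rewrite leey.
  rewrite (_ : (fun x => _) = (fun x => M0 (rcons u x))); first exact: sM.
  by apply/funext => x; rewrite (prefix_trans tu) // prefix_rcons.
- move=> u; case: ifP => tu; last by rewrite leey.
  apply: (@supermartingale_ge M0 0%R) => // w uw.
  by apply: (le_trans (f0 w)); apply: fM; exact: cylinder_prefix uw.
- by rewrite prefix_refl.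
move=> w; have [tw|tw] := pselect (cylinder t w).
  apply: (le_trans (fM _ tw)); apply: (@le_limn_einf _ _ _ (size t)) => n tn.
  by move/(prefix_prefix_at w tn): tw => ->.
apply: (@le_trans _ _ +oo); rewrite ?leey //.
apply: (@limn_einf_ge _ _ _ (size t)) => n tn.
by case: ifP => // /(prefix_prefix_at w tn).
Qed.

(** A supermartingale admissible for [f] at [t] is admissible at every child of [t], so it bounds
    [E f] there. *)
Lemma supermartingale_game (c : R) f : (forall w, c%:E <= f w) ->
  supermartingale Q (E f).
Proof.
move=> cf t; apply: le_ereal_inf_tmp => _ [M [sM bM fM ->]].
apply: le_trans (sM t).
have [B MB] := bM; apply: (ue_monotone (hQ t)).
- by exists c => x; apply: game_ge.
- by exists B.
move=> x; apply: game_le => // w tw; apply: fM.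
by apply: cylinder_prefix tw; rewrite prefix_rcons.
Qed.

Lemma supermartingale_liminf (M_ : nat -> situation X -> \bar R) :
  (forall n, supermartingale Q (M_ n)) -> (forall n t, 0 <= M_ n t) ->
  supermartingale Q (fun t => limn_einf (M_ ^~ t)).
Proof.
move=> sM M0 t.
apply: le_trans (ue_liminf (hQ t) (fun n x => M0 n (rcons t x))) _.
by apply: (@le_limn_einf _ _ _ 0%N) => n _; apply: sM.
Qed.

Lemma supermartingaleD (c d : R) M N : (forall t, c%:E <= M t) ->
  (forall t, d%:E <= N t) -> supermartingale Q M -> supermartingale Q N ->
  supermartingale Q (fun t => M t + N t).
Proof.
move=> cM dN sM sN t.
apply: le_trans (ue_addD (hQ t) (fun x => cM (rcons t x)) (fun x => dN (rcons t x))) _.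
by apply: leeD.
Qed.

Lemma supermartingale_cst (c : R) : supermartingale Q (fun=> c%:E).
Proof. by move=> t; rewrite (ue_cst (hQ t)). Qed.

Lemma supermartingaleZ (c l : R) M : (forall t, c%:E <= M t) -> (0 <= l)%R ->
  supermartingale Q M -> supermartingale Q (fun t => l%:E * M t).
Proof.
move=> cM; rewrite le_eqVlt => /predU1P[<- _ t|l0 sM t].
  rewrite mul0e (_ : (fun x => _) = fun=> 0%:E) ?(ue_cst (hQ t)) //.
  by apply/funext => x; rewrite mul0e.
rewrite (@ue_homogeneous _ _ _ (hQ t) l (fun x => M (rcons t x))) //.
  by rewrite lee_pmul2l ?lte_fin //; apply: sM.
by exists c.
Qed.

Lemma game_addr (c : R) f t : E (fun w => f w + c%:E) t <= E f t + c%:E.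
Proof.
rewrite -leeBlDr //; apply: le_ereal_inf_tmp => _ [M [sM [B MB] fM ->]].
rewrite leeBlDr //; apply: (@game_le (fun u => M u + c%:E)).
- exact: (supermartingaleD MB (fun=> lexx c%:E) sM (supermartingale_cst c)).
- by exists (B + c)%R => u; rewrite EFinD leeD2r.
- move=> w tw; rewrite /liminf_path.
  rewrite (_ : (fun n => _) = (fun n => c%:E + M (prefix_at w n))); last first.
    by apply/funext => n; rewrite addeC.
  by rewrite limn_einf_shift // addeC leeD2l //; exact: fM.
Qed.

(** The series is the lower limit of its partial sums. *)
Lemma supermartingale_nneseries (U : nat -> situation X -> \bar R) :
  (forall k, supermartingale Q (U k)) -> (forall k t, 0 <= U k t) ->
  supermartingale Q (fun t => \sum_(0 <= k <oo) U k t).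
Proof.
move=> sU U0; pose S n t := \sum_(0 <= k < n) U k t.
have S0 n t : 0 <= S n t by apply: sume_ge0.
have sS n : supermartingale Q (S n).
  elim: n => [|n IH] t; rewrite /S.
    rewrite big_nil (_ : (fun x => _) = (fun=> 0%:E)) ?(ue_cst (hQ t)) //.
    by apply/funext => x; rewrite big_nil.
  rewrite big_nat_recr //=.
  rewrite (_ : (fun x => _) = (fun x => S n (rcons t x) + U n (rcons t x))).
    exact: (@supermartingaleD 0 0 (S n) (U n)).
  by apply/funext => x; rewrite big_nat_recr.
move=> t; have := supermartingale_liminf sS S0 t.
have e u : limn_einf (S ^~ u) = \sum_(0 <= k <oo) U k u.
  by rewrite is_cvg_limn_einfE //; apply: is_cvg_nneseries.
by rewrite e; under [X in Q t X]funext do rewrite e.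
Qed.

End game.

(** * Doob upcrossings and Fatou's lemma *)

Section upcrossing.
Variables (R : realType) (X : finType).
Variable Q : situation X -> (X -> \bar R) -> \bar R.
Hypothesis hQ : imprecise_probabilities_tree Q.
Implicit Types (t u : situation X) (w : paths X) (K T : situation X -> \bar R).

Definition diverges T w : Prop :=
  forall A : R, exists N, forall n, (N <= n)%N -> A%:E <= T (prefix_at w n).

(** In a situation [t] with [M t < a], [strategy t] will be a supermartingale worth less than [a] at
    [t] that dominates [g] on all paths. *)
Variables (a b : R) (M : situation X -> \bar R).
Variable strategy : situation X -> situation X -> \bar R.

(* A state is the number of completed upcrossings together with the
   supermartingale currently played, if any. *)
Definition active t (o : option (situation X -> \bar R)) :=
  if o is Some K then Some K
  else if M t < a%:E then Some (strategy t) else None.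

Definition crossing_step t x (p : nat * option (situation X -> \bar R)) :=
  if active t p.2 is Some K then
    if b%:E < K (rcons t x) then (p.1.+1, None) else (p.1, Some K)
  else (p.1, None).

(** Recursion on the reversed string processes the last letter last; [crossing_rcons] recovers the
    forward recursion. *)
Fixpoint crossing_rev (r : seq X) : nat * option (situation X -> \bar R) :=
  if r is x :: r' then crossing_step (rev r') x (crossing_rev r')
  else (0%N, None).

Definition crossing t := crossing_rev (rev t).

(** Each completed upcrossing banks [b - a]. The remainder is the supermartingale being played or,
    between two of them, a reserve [a] that pays for the next. *)
Definition crossing_capital t : \bar R :=
  ((crossing t).1%:R * (b - a))%:E +
  (if (crossing t).2 is Some K then K t else a%:E).

Lemma crossing_rcons t x : crossing (rcons t x) = crossing_step t x (crossing t).
Proof. by rewrite /crossing rev_rcons /= revK. Qed.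

Variable g : paths X -> \bar R.
Hypotheses (a0 : (0 < a)%R) (ab : (a < b)%R).
Hypothesis strategyP : forall t, M t < a%:E ->
  [/\ supermartingale Q (strategy t), forall u, 0 <= strategy t u,
      strategy t t < a%:E & forall w, g w <= liminf_path (strategy t) w].

(** A supermartingale that exceeds [b] is dropped at once, so one that is still held is at most
    [b]. *)
Lemma crossingP t K : (crossing t).2 = Some K ->
  [/\ supermartingale Q K, forall u, 0 <= K u, K t <= b%:E &
      forall w, g w <= liminf_path K w].
Proof.
elim/last_ind: t K => [//|t x IH] K; rewrite crossing_rcons /crossing_step.
case e : (active t _) => [K'|] //; case: ifPn => //= Sb [<-].
move: e Sb; rewrite -leNgt /active.
case e : (crossing t).2 => [K1|].
  by move=> [<-] Kb; have [] := IH _ e.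
by case: ifP => // /strategyP[? ? _ ?] [<-] Kb.
Qed.

Lemma crossing_capital_ge t :
  ((crossing t).1%:R * (b - a))%:E <= crossing_capital t.
Proof.
rewrite /crossing_capital leeDl //.
case e : (crossing t).2 => [K|]; last by rewrite lee_fin ltW.
by have [_ ->] := crossingP e.
Qed.

Lemma crossing_count_ge0 t : (0 <= (crossing t).1%:R * (b - a))%R.
Proof. by rewrite mulr_ge0 // subr_ge0 ltW. Qed.

Lemma crossing_capital_lty t : crossing_capital t < +oo.
Proof.
rewrite /crossing_capital lte_add_pinfty ?ltry //.
case e : (crossing t).2 => [K|]; last by rewrite ltry.
by have [_ _ /le_lt_trans ->] := crossingP e; rewrite ?ltry.
Qed.

(** Starting a supermartingale costs less than the reserve [a], and dropping one swaps a value above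
    [b] for [(b - a) + a]: both are losses. In between the capital moves with the supermartingale,
    and without one it is constant. *)
Lemma crossing_capital_supermartingale : supermartingale Q crossing_capital.
Proof.
move=> t; have [p hp] : exists p, active t (crossing t).2 = p by eexists.
case: p hp => [K|] hp; last first.
  rewrite (_ : (fun x => _) = (fun=> ((crossing t).1%:R * (b - a) + a)%:E)).
    rewrite (ue_cst (hQ t)) /crossing_capital EFinD; move: hp; rewrite /active.
    by case: (crossing t).2.
  apply/funext => x; rewrite /crossing_capital crossing_rcons /crossing_step hp.
  by rewrite EFinD.
have [sS S0 St] : [/\ supermartingale Q K, forall u, 0 <= K u &
    ((crossing t).1%:R * (b - a))%:E + K t <= crossing_capital t].
  move: hp; rewrite /active /crossing_capital.
  case e : (crossing t).2 => [K1|].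
    by move=> [<-]; have [] := crossingP e.
  case: ifP => // /strategyP[? ? /ltW ? _] [<-]; split => //.
  by rewrite leeD2l.
apply: (le_trans _ St).
have := @supermartingaleD _ _ _ hQ ((crossing t).1%:R * (b - a)) 0
  (fun=> ((crossing t).1%:R * (b - a))%:E) K (fun=> lexx _) S0
  (supermartingale_cst hQ _) sS t.
apply: le_trans; apply: (ue_monotone (hQ t)).
- exists 0%R => x; apply: le_trans (crossing_capital_ge _).
  by rewrite lee_fin crossing_count_ge0.
- by exists 0%R => x; rewrite adde_ge0 // lee_fin crossing_count_ge0.
move=> x; rewrite /crossing_capital crossing_rcons /crossing_step hp.
case: ifPn => //= /ltW bS.
by rewrite -EFinD mulrSr mulrDl mul1r -addrA subrK EFinD leeD2l.
Qed.

Lemma crossing_diverges w : liminf_path M w < a%:E -> b%:E < g w ->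
  diverges crossing_capital w.
Proof.
move=> Ma bg; pose p n := crossing (prefix_at w n).
have pS n : p n.+1 = crossing_step (prefix_at w n) (w n) (p n).
  by rewrite /p prefix_atS crossing_rcons.
have p1S n : ((p n).1 <= (p n.+1).1)%N.
  rewrite pS /crossing_step; case: active => [K|] //=.
  by case: ifP => //= _; rewrite leqnSn.
have p1 n m : (n <= m)%N -> ((p n).1 <= (p m).1)%N.
  by apply: (@homo_leq _ (fun n => (p n).1) leq) => //; exact: leq_trans.
have unbounded J : exists N, (J <= (p N).1)%N.
  elim: J => [|J [N JN]]; first by exists 0%N.
  apply: contrapT => /forallNP nJ.
  have pJ n : (N <= n)%N -> (p n).1 = J.
    move=> Nn; apply/eqP; rewrite eqn_leq (leq_trans JN (p1 _ _ Nn)) andbT.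
    by rewrite leqNgt; apply/negP; exact: nJ.
  (* With the count stuck at [J], a supermartingale held at time [n] would be held forever, staying
     at most [b] although its lower limit is at least [g w > b]. *)
  have p2 n : (N <= n)%N -> (p n).2 = None.
    move=> Nn; case e : (p n).2 => [K|//].
    have pm m : p (n + m)%N = (J, Some K).
      elim: m => [|m IH]; first by rewrite addn0 -(pJ _ Nn) -e -surjective_pairing.
      rewrite addnS pS IH /crossing_step /=; case: ifP => // bS.
      have := pJ (n + m).+1 (leq_trans Nn (leq_trans (leq_addr _ _) (leqnSn _))).
      by rewrite pS IH /crossing_step /= bS /= => /esym/n_Sn.
    have [_ _ _ /(_ w)/(lt_le_trans bg)/limn_einf_gt[N' hN']] := crossingP e.
    have := hN' (n + N')%N (leq_addl _ _).
    rewrite ltNge; have e' : (p (n + N')%N).2 = Some K by rewrite pm.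
    by have [_ _ ->] := crossingP e'.
  (* A supermartingale is started when [M] is next below [a]; one step later it is either counted or
     held, and both are excluded. *)
  have [n Nn Mn] : exists2 n, (N <= n)%N & M (prefix_at w n) < a%:E.
    apply: contrapT => /forall2NP h; move: Ma; apply/negP; rewrite -leNgt.
    apply: (@limn_einf_ge _ _ _ N) => n Nn.
    by case: (h n) => [//|/negP]; rewrite -leNgt.
  have := p2 n.+1 (leq_trans Nn (leqnSn _)); have := pJ n.+1 (leq_trans Nn (leqnSn _)).
  rewrite pS /crossing_step /active (p2 _ Nn) Mn; case: ifP => //= _.
  by rewrite (pJ _ Nn) => /esym/n_Sn.
move=> A; have ba : (0 < b - a)%R by rewrite subr_gt0.
have [N hN] := unbounded (Num.truncn (`|A| / (b - a))%R).+1.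
exists N => n Nn; apply: le_trans (crossing_capital_ge _); rewrite lee_fin.
have : (`|A| / (b - a) <= (p n).1%:R)%R.
  apply: ltW; apply: (lt_le_trans (truncnS_gt _)).
  by rewrite ler_nat (leq_trans hN) // p1.
rewrite ler_pdivrMr //; apply: le_trans; exact: ler_norm.
Qed.

End upcrossing.

Section fatou.
Variables (R : realType) (X : finType) (hX : (0 < #|X|)%N).
Variable Q : situation X -> (X -> \bar R) -> \bar R.
Hypothesis hQ : imprecise_probabilities_tree Q.
Local Notation E := (game_upper_expectation Q).

Lemma countable_diverges (U : nat -> situation X -> \bar R) s (e : R) :
  (forall k, supermartingale Q (U k)) -> (forall k t, 0 <= U k t) ->
  (forall k t, U k t < +oo) -> (0 < e)%R ->
  exists V, [/\ supermartingale Q V, forall t, 0 <= V t, V s <= e%:E &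
    forall k w, diverges (U k) w -> diverges V w].
Proof.
move=> sU U0 Uy e0.
(* These weights make the [k]-th term at [s] at most e / 2^(k+1), hence the sum at most [e]; the
   added 1 keeps the divisor positive. *)
pose d k := (e / (2 ^ k.+1)%:R / (1 + fine (U k s)))%R.
have fU k : (0 <= fine (U k s))%R by rewrite fine_ge0.
have d0 k : (0 < d k)%R.
  rewrite /d divr_gt0 ?divr_gt0 ?ltr0n ?expn_gt0 //.
  by apply: ltr_pwDl.
have dU0 k t : 0 <= (d k)%:E * U k t by rewrite mule_ge0 // lee_fin ltW.
exists (fun t => \sum_(0 <= k <oo) ((d k)%:E * U k t)); split.
- apply: supermartingale_nneseries => // k.
  exact: (@supermartingaleZ _ _ _ hQ 0 _ _ (U0 k) (ltW (d0 k))).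
- by move=> t; apply: nneseries_ge0.
- apply: le_trans (epsilon_trick0 _ (ltW e0)).
  apply: lee_nneseries => // k _; rewrite -[U k s]fineK; last first.
    by rewrite ge0_fin_numE.
  rewrite -EFinM lee_fin /d mulrAC ler_pdivrMr; last by apply: ltr_pwDl.
  by rewrite ler_wpM2l ?lerDr // ltW // divr_gt0 // ltr0n expn_gt0.
move=> k w Uw A; have [N hN] := Uw (A / d k)%R; exists N => n Nn.
apply: le_trans (_ : (d k)%:E * U k (prefix_at w n) <= _).
  apply: le_trans (lee_wpmul2l _ (hN n Nn)); last by rewrite lee_fin ltW.
  by rewrite -EFinM lee_fin mulrC divfK // gt_eqF.
apply: le_trans (nneseries_lim_ge k.+1 _) => //.
by rewrite big_nat_recr //= leeDr // sume_ge0.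
Qed.

Lemma game_fatou (f : paths X -> \bar R) (f_ : nat -> paths X -> \bar R) s :
  (forall n w, 0 <= f_ n w) -> (forall w, f w <= limn_einf (f_ ^~ w)) ->
  E f s <= limn_einf (fun n => E (f_ n) s).
Proof.
move=> f0 fle; pose M t := limn_einf (fun n => E (f_ n) t).
have E0 n t : 0 <= E (f_ n) t by apply: game_ge.
have sM : supermartingale Q M.
  apply: supermartingale_liminf => // n.
  exact: (supermartingale_game hX hQ (c := 0) (f0 n)).
have M0 t : 0 <= M t by apply: (@limn_einf_ge _ _ _ 0%N).
(* [k] codes two rational levels and a tail index, so countably many strategies suffice. Codes of no
   triple, or of levels violating 0 < a < b, get the zero supermartingale. *)
have /choice[U hU] : forall k, exists U, [/\ supermartingale Q U,
    forall t, 0 <= U t, forall t, U t < +oo &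
    forall (q : rat * rat * nat) w, unpickle k = Some q ->
      (0 < ratr q.1.1 :> R)%R -> (ratr q.1.1 < ratr q.1.2 :> R)%R ->
      liminf_path M w < (ratr q.1.1)%:E ->
      (ratr q.1.2)%:E < einfs (f_ ^~ w) q.2 -> diverges U w].
  move=> k; case: (unpickle k : option (rat * rat * nat)) => [[[a b] n]|]; last first.
    by exists (fun=> 0%:E); split => //; [exact: supermartingale_cst|move=> t; exact: ltry].
  have [a0|a0] := pselect (0 < ratr a :> R)%R; last first.
    by exists (fun=> 0%:E); split => //;
      [exact: supermartingale_cst|move=> t; exact: ltry|move=> q w [<-]].
  have [ab|ab] := pselect (ratr a < ratr b :> R)%R; last first.
    by exists (fun=> 0%:E); split => //;
      [exact: supermartingale_cst|move=> t; exact: ltry|move=> q w [<-]].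
  have /choice[K hS] : forall t, exists K, M t < (ratr a)%:E ->
      [/\ supermartingale Q K, forall u, 0 <= K u, K t < (ratr a)%:E &
      forall w, einfs (f_ ^~ w) n <= liminf_path K w].
    move=> t; have [Ma|] := pselect (M t < (ratr a)%:E); last by exists M.
    have [||K hS] := @game_lt_dominated _ _ hX _ hQ (fun w => einfs (f_ ^~ w) n) t (ratr a)%:E.
    - by move=> w; apply: le_ereal_inf_tmp => _ [m _ <-].
    (* The infimum of the tail from [n] is below each [f_ m] with [m >= n], so its upper expectation
       at [t] is at most [M t]. *)
    - apply: le_lt_trans Ma; apply: (@limn_einf_ge _ _ _ n) => m nm.
      by apply: le_game => w _; apply: ereal_inf_lbound; exists m.
    by exists K.
  exists (crossing_capital (ratr a) (ratr b) M K); split.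
  - exact: (crossing_capital_supermartingale hQ a0 ab hS).
  - move=> t; apply: le_trans (crossing_capital_ge _ a0 hS _).
    by rewrite lee_fin crossing_count_ge0.
  - exact: (crossing_capital_lty _ hS).
  - move=> q w [<-] /= _ _; exact: (crossing_diverges a0 ab hS).
apply/lee_addgt0Pr => e e0.
have [V [sV V0 Vs VU]] := @countable_diverges U s e
  (fun k => let: And4 h _ _ _ := hU k in h) (fun k => let: And4 _ h _ _ := hU k in h)
  (fun k => let: And4 _ _ h _ := hU k in h) e0.
(* [M + V] costs at most [e] more than [M]; where the lower limit of [M] is below [f], [V]
   diverges. *)
apply: le_trans (leeD (lexx (M s)) Vs).
apply: (@game_le _ _ _ (fun t => M t + V t)).
- exact: (@supermartingaleD _ _ _ hQ 0 0).
- by exists 0%R => t; rewrite adde_ge0.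
move=> w _; have [fM|Mf] := leP (f w) (liminf_path M w).
  apply: (le_trans fM); apply: (@le_limn_einf _ _ _ 0%N) => n _.
  by rewrite leeDl.
have [c [Mc cf]] := lte_between (lt_le_trans Mf (fle w)).
have [d [cd df]] := lte_between cf.
move: cd; rewrite lte_fin => /rat_in_itvoo[a]; rewrite in_itv /= => /andP[ca ad].
have /rat_in_itvoo[b] := ad; rewrite in_itv /= => /andP[ab bd].
have [N hN] := limn_einf_gt df.
have Ma : liminf_path M w < (ratr a)%:E.
  by apply: (lt_trans Mc); rewrite lte_fin.
have a0 : (0 < ratr a :> R)%R.
  rewrite -lte_fin; apply: le_lt_trans Ma.
  by apply: (@limn_einf_ge _ _ _ 0%N) => n _; exact: M0.
have [_ _ _ /(_ (a, b, N) w (pickleK _) a0 ab Ma) Uw] := hU (pickle (a, b, N)).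
have /VU Vw : diverges (U (pickle (a, b, N))) w.
  apply: Uw => /=; apply: (@lt_le_trans _ _ d%:E); first by rewrite lte_fin.
  by apply: le_ereal_inf_tmp => _ [n /= Nn <-]; apply/ltW/hN.
apply: lee_from_below => A _; have [n hn] := Vw A.
apply: (@limn_einf_ge _ _ _ n) => m nm; apply: (le_trans (hn m nm)).
by rewrite leeDr.
Qed.

End fatou.

(** * Uniformly small convex means *)

(** For integer [p], this is the passage from an average of [p] terms to one of [p + 1] terms. *)
Lemma average_le (R : realType) (p x y B : R) : (0 < p)%R ->
  (p * x + y <= B * (p + 1))%R ->
  (p / (p + 1) * x + (1 - p / (p + 1)) * y <= B)%R.
Proof.
move=> p0 h.
have -> : (p / (p + 1) * x + (1 - p / (p + 1)) * y = (p * x + y) / (p + 1))%R.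
  by field; lra.
by rewrite ler_pdivrMr //; lra.
Qed.

Section means.
Variable R : realType.
Implicit Types (L : (nat -> R) -> R) (P : ((nat -> R) -> R) -> Prop).
Implicit Types (F : nat -> (nat -> R) -> R).

Inductive hull P : ((nat -> R) -> R) -> Prop :=
| hull_base L : P L -> hull P L
| hull_conv t L1 L2 : (0 <= t)%R -> (t <= 1)%R -> hull P L1 -> hull P L2 ->
    hull P (fun u => t * L1 u + (1 - t) * L2 u)%R.

Definition tail F (m : nat) : ((nat -> R) -> R) -> Prop :=
  fun L => exists2 j, (m <= j)%N & L = F j.

(* A convex mean is a functional on sequences, so that the same mean can be
   applied to several of them. *)
Definition mean (m : nat) := hull (tail (fun i u => u i) m).

Lemma hull_trans P P' L : (forall L', P L' -> hull P' L') -> hull P L -> hull P' L.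
Proof.
move=> h; elim=> [L' /h//|t L1 L2 t0 t1 _ h1 _ h2]; exact: hull_conv.
Qed.

Lemma hull_tailW F m m' L : (m <= m')%N -> hull (tail F m') L -> hull (tail F m) L.
Proof.
move=> mm'; apply: hull_trans => L' [j m'j ->]; apply: hull_base.
by exists j => //; exact: leq_trans m'j.
Qed.

Lemma hull_tail_mean F m L : (forall j, mean j (F j)) ->
  hull (tail F m) L -> mean m L.
Proof.
move=> hF; apply: hull_trans => L' [j mj ->].
by apply: hull_tailW mj _; exact: hF.
Qed.

Lemma hull_le P L (u : nat -> R) (c : R) :
  (forall L', P L' -> (L' u <= c)%R) -> hull P L -> (L u <= c)%R.
Proof.
move=> h; elim=> [L' /h//|t L1 L2 t0 t1 _ h1 _ h2].
have : (0 <= 1 - t)%R by rewrite subr_ge0.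
by nra.
Qed.

(** Positivity and finite support at once: a mean involves only indices in a finite window starting
    at [m]. *)
Lemma mean_support m L : mean m L -> exists n, forall u v : nat -> R,
  (forall i, (m <= i < n)%N -> (u i <= v i)%R) -> (L u <= L v)%R.
Proof.
elim=> [L' [j mj ->]|t L1 L2 t0 t1 _ [n1 h1] _ [n2 h2]].
  by exists j.+1 => u v; apply; rewrite mj /=.
exists (maxn n1 n2) => u v h.
rewrite lerD // ler_wpM2l ?subr_ge0 //; [apply: h1|apply: h2] => i /andP[mi im];
  by apply: h; rewrite mi leq_max im ?orbT.
Qed.

Lemma mean_mono m L (u v : nat -> R) : mean m L ->
  (forall i, (m <= i)%N -> (u i <= v i)%R) -> (L u <= L v)%R.
Proof.
by move=> /mean_support[n hn] uv; apply: hn => i /andP[mi _]; exact: uv.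
Qed.

Lemma meanD m L (u v : nat -> R) : mean m L ->
  L (fun i => u i + v i)%R = (L u + L v)%R.
Proof.
elim=> [L' [j mj ->]//|t L1 L2 _ _ _ -> _ ->].
by rewrite !mulrDr addrACA.
Qed.

Lemma mean_cst m L (c : R) : mean m L -> L (fun=> c) = c.
Proof.
elim=> [L' [j mj ->]//|t L1 L2 _ _ _ -> _ ->].
by rewrite -mulrDl addrC subrK mul1r.
Qed.

End means.

(** * Mazur's theorem for finitary functions *)

Section uniform_means.
Variables (R : realType) (X : finType) (hX : (0 < #|X|)%N).
Variables (g : nat -> paths X -> R) (c eta : R).
Hypothesis eta0 : (0 <= eta)%R.
Hypothesis gc : forall i w, (g i w <= c)%R.
Implicit Types U V : set (paths X).

(** Quantifying over every sequence of means [F], not only the original terms, makes goodness stable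
    under unions: means already small on one set can be averaged again for another. *)
Definition good U : Prop := forall F : nat -> (nat -> R) -> R,
  (forall j, mean j (F j)) -> forall (d : R) m, (0 < d)%R ->
  exists2 L, hull (tail F m) L &
    forall w, U w -> (L (g ^~ w) <= eta + d)%R.

Lemma goodW U V : V `<=` U -> good U -> good V.
Proof.
move=> VU gU F hF d m d0; have [L hL LU] := gU F hF d m d0.
by exists L => // w /VU/LU.
Qed.

Lemma good_set0 : good set0.
Proof. by move=> F hF d m d0; exists (F m) => //; apply: hull_base; exists m. Qed.

Lemma goodU U V : good U -> good V -> good (U `|` V).
Proof.
move=> gU gV F hF d m d0.
have /choice[F' hF'] : forall j, exists L, hull (tail F j) L /\
    forall w, U w -> (L (g ^~ w) <= eta + d)%R.
  by move=> j; have [L ? ?] := gU F hF d j d0; exists L.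
have mF' j : mean j (F' j) by apply: hull_tail_mean (hF' j).1.
have [L hL LV] := gV F' mF' d m d0; exists L.
  apply: hull_trans hL => L' [j mj ->]; apply: hull_tailW mj _.
  exact: (hF' j).1.
move=> w [Uw|/LV//]; apply: hull_le hL => L' [j mj ->].
exact: (hF' j).2.
Qed.

Lemma good_bigcup (I : eqType) (r : seq I) (U_ : I -> set (paths X)) :
  (forall i, i \in r -> good (U_ i)) ->
  good [set w | exists2 i, i \in r & U_ i w].
Proof.
elim: r => [|i r IH] h; first by apply: goodW good_set0 => w [].
apply: goodW (goodU (h i (mem_head _ _)) (IH _)).
  move=> w [j]; rewrite inE => /predU1P[-> ?|jr ?]; first by left.
  by right; exists j.
by move=> j jr; apply: h; rewrite inE jr orbT.
Qed.

(* At each step the new mean is small where the terms already used are large;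
   so on each path at most one of the averaged means is large. *)
Lemma good_large U m0 :
  (forall n, good (U `&` [set w | exists2 i, (m0 <= i < n)%N & (eta < g i w)%R])) ->
  good U.
Proof.
move=> gUn F hF d m d0; pose m1 := maxn m m0.
have d20 : (0 < d / 2)%R by rewrite divr_gt0.
(* [L] is built as an average of N + 1 means; the last term of the bound pays for the one that may
   be large, which is at most [c]. *)
have step N : exists2 L, hull (tail F m1) L &
    forall w, U w -> (L (g ^~ w) <= eta + d / 2 + c / N.+1%:R)%R.
  elim: N => [|N [L hL LU]].
    exists (F m1); first by apply: hull_base; exists m1.
    move=> w _; apply: (@le_trans _ _ c); last by rewrite divr1 lerDr addr_ge0 // ltW.
    rewrite -(mean_cst c (hF m1)); apply: mean_mono (hF m1) _ => i _.
    exact: gc.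
  have mL := hull_tail_mean hF hL.
  have [n hn] := mean_support mL.
  (* Where some [g i] with [m0 <= i < n] exceeds [eta], [L2] is small; elsewhere [L] is at most
     [eta] and [L2] at most [c]. *)
  have [L2 hL2 L2U] := gUn n F hF (d / 2)%R m1 d20.
  have mL2 := hull_tail_mean hF hL2.
  have N1 : (0 < N.+1%:R :> R)%R by rewrite ltr0n.
  have eN : (N.+2%:R = N.+1%:R + 1 :> R)%R by rewrite -natr1.
  exists (fun u => N.+1%:R / N.+2%:R * L u + (1 - N.+1%:R / N.+2%:R) * L2 u)%R.
    apply: hull_conv => //.
    by rewrite ler_pdivrMr ?ltr0n // mul1r ler_nat.
  move=> w Uw; rewrite eN.
  apply: average_le => //; rewrite mulrDl divfK; last by rewrite gt_eqF // ltr_pwDl.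
  have L2c : (L2 (g ^~ w) <= c)%R.
    by rewrite -[leRHS](mean_cst c mL2); apply: mean_mono mL2 _ => i _; exact: gc.
  have [[i mi gi]|small] :=
      pselect (exists2 i, (m0 <= i < n)%N & (eta < g i w)%R).
    have h2 : (L2 (g ^~ w) <= eta + d / 2)%R by apply: L2U; split => //; exists i.
    have := ler_wpM2l (ltW N1) (LU _ Uw).
    rewrite mulrDr [(_ * (c / _))%R]mulrC divfK; last by lra.
    by lra.
  have h1 : (L (g ^~ w) <= eta)%R.
    rewrite -[leRHS](mean_cst eta mL); apply: hn => i /andP[mi im].
    rewrite leNgt; apply/negP => ei; apply: small; exists i => //.
    by rewrite im andbT (leq_trans _ mi) // leq_maxr.
  have := ler_wpM2l (ltW N1) h1.
  have := eta0; have : (0 <= N.+1%:R * (d / 2))%R by rewrite mulr_ge0 // ltW.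
  by lra.
have [L hL LU] := step (Num.truncn (c / (d / 2))%R).
exists L; first by apply: hull_tailW hL; rewrite leq_maxl.
move=> w /LU/le_trans; apply.
rewrite -addrA lerD2l [leRHS](splitr d) lerD2l ler_pdivrMr ?ltr0n //.
by rewrite mulrC -ler_pdivrMr // ltW // truncnS_gt.
Qed.

Hypothesis g_finitary : forall i, finitary (g i).

(** By [good_large] and finite unions, the part of the cylinder where a single late [g i] exceeds
    [eta] is already bad. Splitting it into finitely many cylinders leaves a bad one, and a bad set
    is non-empty. *)
Lemma bad_extend u m0 : ~ good (cylinder u) ->
  exists v, [/\ prefix u v, (size u < size v)%N, ~ good (cylinder v) &
    exists2 i, (m0 <= i)%N & forall w, cylinder v w -> (eta < g i w)%R].
Proof.
move=> bu.
have [i mi bi] : exists2 i, (m0 <= i)%N &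
    ~ good (cylinder u `&` [set w | (eta < g i w)%R]).
  apply: contrapT => /forall2NP h; apply: bu; apply: (@good_large _ m0) => n.
  apply: goodW (@good_bigcup _ (iota m0 (n - m0))
    (fun i => cylinder u `&` [set w | (eta < g i w)%R]) _).
    move=> w [uw [i /andP[mi im] gi]]; exists i => //.
    by rewrite mem_iota mi subnKC // ltnW // (leq_ltn_trans mi im).
  move=> i; rewrite mem_iota => /andP[mi _].
  by case: (h i) => // /contrapT.
(* Length [N] makes [g i] constant on cylinders and is strictly larger than that of [u]. *)
have [k gk] := g_finitary i; pose N := maxn k (size u).+1.
have [v bv] : exists v : N.-tuple X,
    ~ good (cylinder u `&` [set w | (eta < g i w)%R] `&` cylinder v).
  apply: contrapT => /forallNP h; apply: bi.
  apply: goodW (@good_bigcup _ (enum {: N.-tuple X})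
    (fun v => cylinder u `&` [set w | (eta < g i w)%R] `&` cylinder v) _).
    move=> w uw; have sN : size (prefix_at w N) == N by rewrite size_prefix_at.
    exists (Tuple sN); rewrite ?mem_enum //; split => //.
    by rewrite /cylinder /= size_prefix_at.
  by move=> v _; apply: contrapT; exact: h.
have [w0 [[uw0 gw0] vw0]] : exists w,
    (cylinder u `&` [set w | (eta < g i w)%R] `&` cylinder v) w.
  apply: contrapT => /forallNP h; apply: bv.
  by apply: goodW good_set0 => w /h.
have vN : prefix_at w0 N = v by move: vw0; rewrite /cylinder /= size_tuple.
exists v; split.
- by rewrite -vN; apply/prefix_prefix_at; rewrite // leq_max leqnSn orbT.
- by rewrite size_tuple leq_max leqnn orbT.
- by move=> gv; apply: bv; apply: goodW gv => w [].
exists i => // w; rewrite /cylinder /= size_tuple -vN => ww0.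
rewrite (gk w w0) // -(take_prefix_at w (leq_maxl k (size u).+1)).
by rewrite -(take_prefix_at w0 (leq_maxl k (size u).+1)) -/N ww0.
Qed.

Hypothesis g_small : forall w, exists N, forall i, (N <= i)%N -> (g i w <= eta)%R.

(** Compactness: were the whole space bad, nested bad cylinders would determine a path on which
    [g i] exceeds [eta] for arbitrarily large [i]. *)
Lemma uniform_mean (e : R) m : (0 < e)%R ->
  exists2 L, mean m L & forall w, (L (g ^~ w) <= eta + e)%R.
Proof.
move=> e0; suff gT : good (cylinder [::]).
  have [|L hL LT] := gT (fun i u => u i) _ e m e0.
    by move=> j; apply: hull_base; exists j.
  by exists L => // w; apply: LT.
apply: contrapT => bad.
have /choice[F hF] : forall p : situation X * nat, exists v,
    ~ good (cylinder p.1) -> [/\ prefix p.1 v, (size p.1 < size v)%N,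
    ~ good (cylinder v) &
    exists2 i, (p.2 <= i)%N & forall w, cylinder v w -> (eta < g i w)%R].
  move=> [u k]; have [gu|/(@bad_extend _ k)[v hv]] := pselect (good (cylinder u)).
    by exists u.
  by exists v.
pose v := fix v k := if k is k'.+1 then F (v k', k') else [::].
have bv k : ~ good (cylinder (v k)).
  by elim: k => //= k /(hF (v k, k))[].
have [||w hw] := @path_of_chain _ hX v.
- by move=> k; have [] := hF (v k, k) (bv k).
- by move=> k; have [] := hF (v k, k) (bv k).
have [N hN] := g_small w.
have [_ _ _ [i Ni /(_ w (hw N.+1))]] := hF (v N, N) (bv N).
by rewrite ltNge hN.
Qed.

End uniform_means.

(** * Finitary approximation *)

Lemma cvge_eventually_ge (R : realType) (u : nat -> \bar R) (l a : \bar R) :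
  u n @[n --> \oo] --> l -> a < l -> exists N, forall n, (N <= n)%N -> a <= u n.
Proof.
move=> ul; rewrite -(cvg_limn_einf_sup ul).1 => /limn_einf_gt[N hN].
by exists N => n /hN/ltW.
Qed.

Lemma cvge_eventually_le (R : realType) (u : nat -> \bar R) (l b : \bar R) :
  u n @[n --> \oo] --> l -> l < b -> exists N, forall n, (N <= n)%N -> u n <= b.
Proof.
move=> /cvgeN ul; rewrite -lteN2 => /(cvge_eventually_ge ul)[N hN].
by exists N => n /hN; rewrite leeN2.
Qed.

Section clip.
Variable R : realType.
Implicit Types (x : \bar R) (a c : R).

Definition clip c x : R := fine (Order.min (Order.max x 0) c%:E).

Lemma clipE c x : (0 <= c)%R -> (clip c x)%:E = Order.min (Order.max x 0) c%:E.
Proof.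
move=> c0; rewrite /clip fineK // ge0_fin_numE.
  by rewrite gt_min ltry orbT.
by rewrite le_min le_max lexx orbT lee_fin.
Qed.

Lemma clip_ge0 c x : (0 <= c)%R -> (0 <= clip c x)%R.
Proof.
by move=> c0; rewrite -lee_fin clipE // le_min le_max lexx orbT lee_fin.
Qed.

Lemma clip_le c x : (0 <= c)%R -> (clip c x <= c)%R.
Proof. by move=> c0; rewrite -lee_fin clipE // ge_min lexx orbT. Qed.

Lemma le_clip c x a : (0 <= c)%R -> (a <= c)%R -> a%:E <= x -> (a <= clip c x)%R.
Proof.
by move=> c0 ac ax; rewrite -lee_fin clipE // le_min le_max ax /= lee_fin.
Qed.

Lemma clip_le_id c x : (0 <= c)%R -> 0 <= x -> (clip c x)%:E <= x.
Proof. by move=> c0 x0; rewrite clipE // ge_min ge_max lexx x0. Qed.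

Lemma clip_ub c x a : (0 <= c)%R -> (0 <= a)%R -> x <= a%:E -> (clip c x <= a)%R.
Proof.
by move=> c0 a0 xa; rewrite -lee_fin clipE // ge_min ge_max xa /= lee_fin a0.
Qed.

End clip.

Lemma n_measurableW (X : finType) (T : Type) m n (f : paths X -> T) :
  (m <= n)%N -> n_measurable m f -> n_measurable n f.
Proof.
move=> mn fm w w' e; apply: fm.
by rewrite -(take_prefix_at w mn) -(take_prefix_at w' mn) e.
Qed.

Lemma finitary_mean (R : realType) (X : finType) (h : nat -> paths X -> R) m L :
  (forall i, finitary (h i)) -> mean m L -> finitary (fun w => L (h ^~ w)).
Proof.
move=> fh; elim=> [L' [j _ ->]|t L1 L2 _ _ _ [n1 h1] _ [n2 h2]]; first exact: fh.
exists (maxn n1 n2) => w w' e.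
rewrite (n_measurableW (leq_maxl n1 n2) h1 e).
by rewrite (n_measurableW (leq_maxr n1 n2) h2 e).
Qed.

(** Repeating terms turns a sequence with [N_ k]-measurable terms into one whose [n]-th term is
    [n]-measurable. The index [k n] is the largest [i <= n] with [N_ i <= n]; [N_ 0 = 0] makes 0 a
    candidate. *)
Lemma slow_index (N_ : nat -> nat) : N_ 0%N = 0%N ->
  exists k : nat -> nat, (forall n, (N_ (k n) <= n)%N) /\
    forall K, exists n0, forall n, (n0 <= n)%N -> (K <= k n)%N.
Proof.
move=> N0; pose k n : nat := [arg max_(i > @ord0 n | (N_ i <= n)%N) i].
exists k; split => [n|K].
  by rewrite /k; case: arg_maxnP => //=; rewrite N0.
exists (maxn K (N_ K)) => n; rewrite geq_max => /andP[Kn NKn].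
rewrite /k; case: arg_maxnP => /= [|i _ /(_ (inord K))]; first by rewrite N0.
by rewrite inordK // => /(_ NKn).
Qed.

(** * Upper expectations of means of finitary functions *)

Section approximation.
Variables (R : realType) (X : finType) (hX : (0 < #|X|)%N).
Variable Q : situation X -> (X -> \bar R) -> \bar R.
Hypothesis hQ : imprecise_probabilities_tree Q.
Local Notation E := (game_upper_expectation Q).

Lemma supermartingale_clip (M : situation X -> \bar R) (c : R) : (0 <= c)%R ->
  supermartingale Q M -> (forall t, 0 <= M t) ->
  supermartingale Q (fun t => (clip c (M t))%:E).
Proof.
move=> c0 sM M0 t; have b0 : bounded_below (fun x => (clip c (M (rcons t x)))%:E).
  by exists 0%R => x; rewrite lee_fin clip_ge0.
rewrite [leRHS]clipE // le_min; apply/andP; split.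
  rewrite le_max; apply/orP; left; apply: le_trans (sM t).
  apply: (ue_monotone (hQ t)) => //; first by exists 0%R.
  by move=> x; exact: clip_le_id.
rewrite -[leRHS](ue_cst (hQ t)); apply: (ue_monotone (hQ t)) => //.
  by exists c.
by move=> x; rewrite lee_fin clip_le.
Qed.

(** [K (take i t)] is [K] stopped at time [i]; stopping and convex combination both preserve
    supermartingales. *)
Lemma supermartingale_mean (K : situation X -> R) m L : mean m L ->
  (forall t, 0 <= K t)%R -> supermartingale Q (fun t => (K t)%:E) ->
  supermartingale Q (fun t => (L (fun i => K (take i t)))%:E).
Proof.
move=> mL K0 sK; elim: mL => [L' [j _ ->] t|r L1 L2 r0 r1 m1 s1 m2 s2].
  have [jt|tj] := leqP j (size t).
    rewrite (_ : (fun x => _) = fun=> (K (take j t))%:E) ?(ue_cst (hQ t)) //.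
    by apply/funext => x; rewrite -cats1 takel_cat.
  rewrite (_ : (fun x => _) = fun x => (K (rcons t x))%:E).
    by rewrite take_oversize 1?ltnW //; exact: sK.
  by apply/funext => x; rewrite take_oversize // size_rcons.
have p0 L0 t : hull (tail (fun i u => u i) m) L0 ->
    0 <= (L0 (fun i => K (take i t)))%:E.
  move=> h; rewrite lee_fin -{1}(mean_cst 0%R h).
  by apply: (mean_mono h) => i _; exact: K0.
have r1' : (0 <= 1 - r)%R by rewrite subr_ge0.
have pZ (l : R) L0 t : (0 <= l)%R -> hull (tail (fun i u => u i) m) L0 ->
    0%:E <= l%:E * (L0 (fun i => K (take i t)))%:E.
  by move=> l0 h; rewrite mule_ge0 ?lee_fin // -lee_fin p0.
exact: (@supermartingaleD _ _ _ hQ 0 0 _ _ (fun t => pZ _ _ t r0 m1)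
  (fun t => pZ _ _ t r1' m2)
  (@supermartingaleZ _ _ _ hQ 0 r _ (fun t => p0 _ t m1) r0 s1)
  (@supermartingaleZ _ _ _ hQ 0 _ _ (fun t => p0 _ t m2) r1' s2)).
Qed.

(* For a supermartingale M with liminf M >= f, the excess of h_i over the
   clipped value of M at time i vanishes pointwise, hence uniformly along some
   mean; the same mean of the versions of M stopped at i has value <= M s. *)
Lemma game_mean_le (f : paths X -> \bar R) (h : nat -> paths X -> R) (c e : R) s m :
  (forall w, 0 <= f w) -> (0 <= c)%R -> (forall i w, (h i w <= c)%R) ->
  (forall i, finitary (h i)) ->
  (forall w (b : R), f w < b%:E ->
    exists N, forall i, (N <= i)%N -> (h i w <= b)%R) ->
  (0 < e)%R -> E f s < +oo ->
  exists2 L, mean m L & E (fun w => (L (h ^~ w))%:E) s <= E f s + e%:E.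
Proof.
move=> f0 c0 hc fh hf e0 Efy.
have Ef : E f s \is a fin_num.
  by rewrite ge0_fin_numE //; apply: game_ge.
(* The error [e] is split into [e / 4] for the choice of [M], [e / 2] for the pointwise bound on [g]
   and [e / 4] for its uniform version. *)
have e40 : (0 < e / 4)%R by rewrite divr_gt0.
have [||M [sM M0 Ms fM]] := @game_lt_dominated _ _ hX _ hQ f s (E f s + (e / 4)%:E).
- exact: f0.
- by rewrite lteDl // lte_fin.
pose K t := clip c (M t).
have K0 t : (0 <= K t)%R by apply: clip_ge0.
pose g i w := (h i w - K (prefix_at w i))%R.
have gc i w : (g i w <= c)%R by rewrite /g lerBlDr (le_trans (hc i w)) // lerDl.
have fg i : finitary (g i).
  have [n hn] := fh i; exists (maxn n i) => w w' ww'; rewrite /g.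
  rewrite (n_measurableW (leq_maxl n i) hn ww').
  by rewrite -(take_prefix_at w (leq_maxr n i)) ww' take_prefix_at // leq_maxr.
(* If [f w >= c], then [h] is at most [c] while [K] gets within [e / 4] of [c]. Otherwise [f w] is
   finite, and eventually [h] is at most [f w + e / 4] and [K] at least [f w - e / 4]. *)
have gs w : exists N, forall i, (N <= i)%N -> (g i w <= e / 2)%R.
  have [cf|fc] := leP c%:E (f w).
    have /limn_einf_gt[N hN] : (c - e / 4)%:E < liminf_path M w.
      by apply: lt_le_trans (le_trans cf (fM w)); rewrite lte_fin gtrBl.
    exists N => i Ni.
    have : (c - e / 4 <= K (prefix_at w i))%R.
      by apply: le_clip => //; [rewrite gerBl ltW|exact/ltW/hN].
    have := hc i w; rewrite /g; lra.
  have fr : f w = (fine (f w))%:E.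
    by rewrite fineK // ge0_fin_numE // (lt_trans fc) ?ltry.
  set r := fine (f w) in fr; rewrite fr lte_fin in fc.
  have [|N1 hN1] := hf w (r + e / 4)%R; first by rewrite fr lte_fin ltrDl.
  have /limn_einf_gt[N2 hN2] : (r - e / 4)%:E < liminf_path M w.
    by apply: lt_le_trans (fM w); rewrite fr lte_fin gtrBl.
  exists (maxn N1 N2) => i; rewrite geq_max => /andP[i1 i2].
  have : (r - e / 4 <= K (prefix_at w i))%R.
    apply: le_clip => //; [|exact/ltW/hN2].
    by rewrite lerBlDr (le_trans (ltW fc)) // lerDl ltW.
  have := hN1 i i1; rewrite /g; lra.
have e20 : (0 <= e / 2)%R by rewrite divr_ge0 // ltW.
(* Indices from [size s] on ensure that no stopped copy of [K] has stopped before [s], so each has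
   value [K s] there. *)
have [L mL Lg] := @uniform_mean R X hX g c (e / 2)%R e20 gc fg gs (e / 4)%R
  (maxn m (size s)) e40.
exists L; first by apply: hull_tailW mL; exact: leq_maxl.
pose S t := (L (fun i => K (take i t)))%:E + (e / 2 + e / 4)%:E.
have S0 t : 0 <= (L (fun i => K (take i t)))%:E.
  by rewrite lee_fin -(mean_cst 0%R mL); apply: (mean_mono mL).
apply: (@le_trans _ _ (S s)).
  apply: game_le.
  - apply: (@supermartingaleD _ _ _ hQ 0 (e / 2 + e / 4) _ _ S0 (fun=> lexx _)).
      by apply: (supermartingale_mean mL K0); exact: supermartingale_clip.
    exact: supermartingale_cst.
  - exists 0%R => t; apply: adde_ge0; first exact: S0.
    by rewrite lee_fin addr_ge0 // ltW.
  (* From time [N] on, all stopped copies averaged by [L] have stopped. *)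
  move=> w _; have [N hN] := mean_support mL.
  apply: (@limn_einf_ge _ _ _ N) => n Nn.
  have -> : h ^~ w = (fun i => K (prefix_at w i) + g i w)%R.
    by apply/funext => i; rewrite /g addrC subrK.
  rewrite (meanD _ _ mL) EFinD; apply: leeD; rewrite lee_fin //.
  apply: hN => i /andP[_ iN]; rewrite take_prefix_at //.
  by rewrite (leq_trans (ltnW iN)).
apply: (@le_trans _ _ (M s + (e / 2 + e / 4)%:E)).
  rewrite leeD2r //; apply: le_trans (clip_le_id c0 (M0 s)); rewrite lee_fin.
  rewrite -[leRHS](mean_cst (clip c (M s)) mL); apply: (mean_mono mL) => i.
  by rewrite geq_max => /andP[_ si]; rewrite take_oversize.
apply: le_trans (leeD (ltW Ms) (lexx _)) _.
rewrite -addeA leeD2l // -EFinD lee_fin; lra.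
Qed.

Lemma game_finitary_approximation (f : paths X -> \bar R)
    (F : nat -> paths X -> \bar R) s :
  (forall w, 0 <= f w) -> (forall n, finitary (F n)) ->
  (forall w, F n w @[n --> \oo] --> f w) ->
  exists h : nat -> paths X -> R,
    [/\ forall n w, (0 <= h n w)%R,
        forall n, exists C : R, forall w, (h n w <= C)%R,
        forall n, n_measurable n (h n),
        forall w, (h n w)%:E @[n --> \oo] --> f w
      & E (fun w => (h n w)%:E) s @[n --> \oo] --> E f s].
Proof.
move=> f0 fF Ff.
have /choice[L hL] : forall k, exists L, mean k L /\
    E (fun w => (L (fun i => clip k%:R (F i w)))%:E) s <=
    E f s + (k.+1%:R^-1)%:E.
  move=> k; have [Efy|/negP] := pselect (E f s < +oo).
    have [|||||||L mL EL] := @game_mean_le f (fun i w => clip k%:R (F i w))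
        k%:R k.+1%:R^-1 s k => //.
    - by move=> i w; exact: clip_le.
    - move=> i; have [n hn] := fF i; exists n => w w' ww'.
      by rewrite (hn _ _ ww').
    - move=> w b fb; have [N hN] := cvge_eventually_le (Ff w) fb.
      exists N => i /hN; apply: clip_ub => //.
      by rewrite -lee_fin ltW // (le_lt_trans (f0 w)).
    by exists L.
  (* When [E f s] is +oo the bound is void and any mean will do. *)
  rewrite -leNgt leye_eq => /eqP ->; exists (fun u => u k); split.
    by apply: hull_base; exists k.
  by rewrite addye // leey.
pose H k w := L k (fun i => clip k%:R (F i w)).
have mL k := (hL k).1.
have Hge k w (a : R) : (a <= k%:R)%R ->
    (forall i, (k <= i)%N -> a%:E <= F i w) -> (a <= H k w)%R.
  move=> ak aF; rewrite -(mean_cst a (mL k)); apply: (mean_mono (mL k)) => i ki.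
  by apply: le_clip => //; exact: aF.
have Hle k w (b : R) : (0 <= b)%R ->
    (forall i, (k <= i)%N -> F i w <= b%:E) -> (H k w <= b)%R.
  move=> b0 Fb; rewrite -(mean_cst b (mL k)); apply: (mean_mono (mL k)) => i ki.
  by apply: clip_ub => //; exact: Fb.
have H0 k w : (0 <= H k w)%R.
  by rewrite -(mean_cst 0%R (mL k)); apply: (mean_mono (mL k)) => i _; exact: clip_ge0.
have Hk k w : (H k w <= k%:R)%R.
  by rewrite -(mean_cst k%:R (mL k)); apply: (mean_mono (mL k)) => i _; exact: clip_le.
(* [H 0] is clipped to [0, 0], hence constant; this gives the [N_ 0 = 0] that [slow_index] asks
   for. *)
have /choice[N_ hN_] : forall k, exists n, n_measurable n (H k) /\ (k = 0%N -> n = 0%N).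
  case=> [|k].
    exists 0%N; split => // w w' _.
    have H00 v : H 0%N v = 0%R by apply/eqP; rewrite eq_le H0 Hk.
    by rewrite !H00.
  have [|n hn] := @finitary_mean R X (fun i w => clip k.+1%:R (F i w)) _ _ _ (mL k.+1).
    move=> i; have [n hn] := fF i; exists n => w w' ww'.
    by rewrite (hn _ _ ww').
  by exists n.
have [k [kn koo]] := slow_index ((hN_ 0%N).2 erefl).
have cvgH w : (H (k n) w)%:E @[n --> \oo] --> f w.
  apply: cvge_from_bounds => [a af|b fb].
    have [N hN] := cvge_eventually_ge (Ff w) af.
    have [n0 hn0] := koo (maxn N (Num.truncn a).+1).
    exists n0 => n /hn0; rewrite geq_max lee_fin => /andP[Nk ak].
    apply: Hge => [|i ki]; last by apply: hN; exact: leq_trans ki.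
    by apply: le_trans (ltW (truncnS_gt a)) _; rewrite ler_nat.
  have [N hN] := cvge_eventually_le (Ff w) fb.
  have [n0 hn0] := koo N; exists n0 => n /hn0 Nk; rewrite lee_fin.
  apply: Hle => [|i ki]; last by apply: hN; exact: leq_trans ki.
  by rewrite -lee_fin ltW // (le_lt_trans (f0 w)).
exists (fun n => H (k n)); split => //.
- by move=> n; exists (k n)%:R.
- by move=> n; apply: n_measurableW (kn n) _; exact: (hN_ _).1.
(* The lower bound is Fatou's lemma; the upper one is the choice of [L], with error 1 / (k n +
   1). *)
apply: cvge_from_bounds => [a aE|b Eb].
  have : a%:E < limn_einf (fun n => E (fun w => (H (k n) w)%:E) s).
    apply: (lt_le_trans aE); apply: (game_fatou hX hQ) => [n w|w].
      by rewrite lee_fin.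
    by rewrite (cvg_limn_einf_sup (cvgH w)).1.
  by move=> /limn_einf_gt[N hN]; exists N => n /hN/ltW.
have Ef0 : 0 <= E f s by apply: game_ge.
have Er : E f s = (fine (E f s))%:E.
  by rewrite fineK // ge0_fin_numE // (lt_trans Eb) ?ltry.
set r := fine (E f s) in Er; rewrite Er lte_fin -subr_gt0 in Eb.
have [n0 hn0] := koo (Num.truncn (b - r)^-1%R).
exists n0 => n /hn0 nk; apply: (le_trans (hL (k n)).2).
rewrite Er -EFinD lee_fin -lerBrDl -[leRHS]invrK lef_pV2 ?posrE ?ltr0n ?invr_gt0 //.
by apply: le_trans (ltW (truncnS_gt _)) _; rewrite ler_nat.
Qed.

(** The missing inequality is [game_addr] for [- c] and the translated function. *)
Lemma gameD_cst (f : paths X -> \bar R) (c : R) s :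
  E (fun w => f w + c%:E) s = E f s + c%:E.
Proof.
apply/eqP; rewrite eq_le game_addr //= -leeBrDr //.
have := game_addr hQ (- c) (fun w => f w + c%:E) s.
by under [X in E X]funext do rewrite EFinN addeK //.
Qed.

End approximation.

Theorem theorem32 (R : realType) (X : finType) (hX : (0 < #|X|)%N)
    (Q : situation X -> (X -> \bar R) -> \bar R)
    (hQ : imprecise_probabilities_tree Q)
    (s : situation X) (f : paths X -> \bar R) (hf : bounded_below_finitary_limit f) :
  exists f_ : nat -> paths X -> R,
    [/\ forall n, gamble (f_ n),
        forall n, n_measurable n (f_ n),
        exists M : R, forall n w, (M <= f_ n w)%R,
        forall w, (f_ n w)%:E @[n --> \oo] --> f w
      & game_upper_expectation Q (fun w => (f_ n w)%:E) s @[n --> \oo]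
          --> game_upper_expectation Q f s].
Proof.
case: hf => -[B Bf] [F [fF Ff]].
(* Subtracting the lower bound [B] reduces to a non-negative limit; [gameD_cst] restores it. *)
have [|||h [h0 hC hm hf hE]] := @game_finitary_approximation R X hX Q hQ
    (fun w => f w - B%:E) (fun n w => F n w - B%:E) s.
- by move=> w; rewrite sube_ge0.
- by move=> n; have [m hm] := fF n; exists m => w w' ww'; rewrite (hm _ _ ww').
- by move=> w; apply: cvgeB => //; [exact: fin_num_adde_defl|exact: cvg_cst].
have fB : f = (fun w => f w - B%:E + B%:E) by apply/funext => w; rewrite subeK.
exists (fun n w => h n w + B)%R; split.
- move=> n; have [C hCn] := hC n.
  exists (`|C| + `|B|)%R; split; first exact: num_real.
  move=> x Cx w _ /=; apply: le_trans (ltW Cx); apply: (le_trans (ler_normD _ _)).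
  rewrite lerD2r ger0_norm //; apply: le_trans (hCn w) (ler_norm _).
- by move=> n w w' /hm ->.
- by exists B => n w; rewrite lerDr.
- move=> w; rewrite fB; under eq_fun do rewrite EFinD.
  by apply: cvgeD; [exact: fin_num_adde_defl|exact: hf|exact: cvg_cst].
rewrite [in X in _ --> X]fB gameD_cst //.
have hB n := gameD_cst hQ (fun w => (h n w)%:E) B s.
under eq_fun do rewrite hB.
by apply: cvgeD; [exact: fin_num_adde_defl|exact: hE|exact: cvg_cst].
Qed.
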